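(* Let $A_0\in\mathbb{C}^{n\times n}$ be a non-derogatory matrix and let $A_0=U_0T_0U_0^*$ be a Schur decomposition of $A_0$. Then there exist constants $K,\varepsilon>0$ (depending on $A_0$ only) such that for every $A\in\mathbb{C}^{n\times n}$ with $\|A-A_0\|<\varepsilon$ there exists a Schur decomposition $A=UTU^*$ of $A$ satisfying $$\|U-U_0\|+\|T-T_0\|\le K\|A-A_0\|^{1/n}.$$
   Context: A Schur decomposition (Schur factorization) of a matrix $A\in\mathbb{C}^{n\times n}$ is a factorization $A=UTU^*$ with $U\in\mathbb{C}^{n\times n}$ unitary and $T\in\mathbb{C}^{n\times n}$ upper triangular. A matrix is non-derogatory if its Jordan form has exactly one Jordan block for each distinct eigenvalue. $\|\cdot\|$ denotes the operator norm on $\mathbb{C}^{n\times n}$ induced by the Euclidean norm. *)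

(* Defs.v *)
From HB Require Import structures.
From mathcomp Require Import all_boot all_order all_algebra.
From mathcomp Require Import complex.
From mathcomp Require Import all_classical all_reals all_analysis.

Set Implicit Arguments.
Unset Strict Implicit.
Unset Printing Implicit Defensive.

Import Order.TTheory GRing.Theory Num.Theory.
Local Open Scope classical_set_scope.
Local Open Scope ring_scope.
Local Open Scope sesquilinear_scope.

Definition eucl_norm (R : realType) (n : nat) (x : 'cV[R[i]]_n) : R :=
  Num.sqrt (\sum_(k < n) ComplexField.Normc.normc (x k 0) ^+ 2).

(* The set is nonempty and bounded above in finite dimension, so that sup is
   the true least upper bound. *)
Definition op_norm (R : realType) (n : nat) (A : 'M[R[i]]_n) : R :=
  sup [set eucl_norm (A *m x) | x in [set x : 'cV[R[i]]_n | eucl_norm x <= 1]].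

(* is_trig_mx means lower triangular, hence the transpose. *)
Definition upper_triangular (R : realType) (n : nat) (T : 'M[R[i]]_n) : bool :=
  is_trig_mx T^T.

Definition schur_decomposition (R : realType) (n : nat) (A U T : 'M[R[i]]_n) :
    Prop :=
  [/\ U \is unitarymx, upper_triangular T & A = U *m T *m U^t*].

Definition jordan_block (R : realType) (m : nat) (lam : R[i]) : 'M[R[i]]_m :=
  \matrix_(k, l) (lam *+ (k == l) + (k.+1 == l :> nat)%:R).

(* A is similar to the direct sum of r Jordan blocks, the k-th one having
   size p k > 0 and eigenvalue lam k. *)
Definition has_jordan_form (R : realType) (n : nat) (A : 'M[R[i]]_n)
    (r : nat) (p : 'I_r -> nat) (lam : 'I_r -> R[i]) : Prop :=
  (forall k, (0 < p k)%N) /\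
  exists e : (\sum_k p k)%N = n,
    A ~_{in unitmx} castmx (e, e) (\mxdiag_k jordan_block (p k) (lam k)).

(* Jordan forms are unique up to the order of the blocks, so that it does not
   matter which one is considered. *)
Definition nonderogatory (R : realType) (n : nat) (A : 'M[R[i]]_n) : Prop :=
  exists (r : nat) (p : 'I_r -> nat) (lam : 'I_r -> R[i]),
    has_jordan_form A p lam /\ injective lam.

(* Main.v *)
Require Import Defs.
From mathcomp Require Import all_boot all_order all_algebra.
From mathcomp Require Import complex.
From mathcomp Require Import all_classical all_reals all_analysis.
From mathcomp Require Import perm.
From mathcomp Require Import ring lra.

(** A Schur form is built one eigenvector at a time, and each step costs only a
    factor, not a power, of the distance once the eigenvalues of the two
    matrices have been compared.

    After conjugation by U0 the unperturbed matrix is T0 itself, upper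
    triangular with first diagonal entry l0, and B is a matrix close to T0.
    By continuity of the determinant B has an eigenvalue mu near l0
    (eigenvalue_near).  Because A0 is non-derogatory, T0 - l0 has a
    one-dimensional kernel, spanned by the first basis vector, and this is made
    quantitative by a matrix G of bounded norm such that G (T0 - l0) differs
    from the identity by a matrix of rank at most 1.  An eigenvector of B for
    mu therefore deviates from the first basis vector by at most a constant
    times |B - T0| + |mu - l0| (eigenvector_near).  A unitary W close to the
    identity carries the first basis vector onto its direction
    (unitary_completion), conjugation by W splits mu off, and the remaining
    block is close to the lower right block of T0, which inherits G
    (left_quasi_inverse_drsubmx).  Induction gives B = V T V^* with V - 1
    bounded by a constant times |B - T0| + sum |T i i - T0 i i|
    (schur_lipschitz_diag).  The constant does not depend on how close the
    diagonals are required to be, although the admissible |B - T0| does.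

    The exponent 1/n enters once, in a comparison of the diagonals.  When they
    differ by less than half the gap between distinct eigenvalues of A0, the
    eigenvalue of A0 nearest to T i i is T0 i i, so
    |T i i - T0 i i|^n <= prod_j |T i i - T0 j j| = |det (T i i - T0)|, and the
    last number is O(|B - T0|) because det (T i i - B) = 0 and the determinant
    is Lipschitz on bounded sets (schur_diag_holder).  Using this inside the
    induction instead would compound the exponents.

    All constants depend on A0 only, because a G for each eigenvalue of A0 is
    transported to every Schur form of A0 by unitary conjugation. *)

Import Order.TTheory GRing.Theory Num.Theory.
Local Open Scope ring_scope.
Local Open Scope sesquilinear_scope.

Set Implicit Arguments.
Unset Strict Implicit.
Unset Printing Implicit Defensive.

(** * The modulus, as a real number *)

Local Notation cabs := ComplexField.Normc.normc.

Section Modulus.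
Context {R : realType}.
Implicit Types z w : R[i].

Lemma normr_cabs z : `|z| = (cabs z)%:C%C.
Proof. by []. Qed.

Lemma cabs_ge0 z : 0 <= cabs z.
Proof. by case: z => x y; apply: sqrtr_ge0. Qed.

Lemma cabs0 : cabs (0 : R[i]) = 0.
Proof. exact: ComplexField.Normc.normc0. Qed.

Lemma cabs1 : cabs (1 : R[i]) = 1.
Proof. exact: ComplexField.Normc.normc1. Qed.

Lemma cabs_eq0 z : (cabs z == 0) = (z == 0).
Proof.
by apply/eqP/eqP => [/ComplexField.Normc.eq0_normc //|->]; rewrite cabs0.
Qed.

Lemma cabsM z w : cabs (z * w) = cabs z * cabs w.
Proof. exact: ComplexField.Normc.normcM. Qed.

Lemma cabsV z : cabs z^-1 = (cabs z)^-1.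
Proof. exact: ComplexField.Normc.normcV. Qed.

Lemma cabsD z w : cabs (z + w) <= cabs z + cabs w.
Proof. by have := ler_normD z w; rewrite !normr_cabs -rmorphD lecR. Qed.

Lemma cabsN z : cabs (- z) = cabs z.
Proof. by have := normrN z; rewrite !normr_cabs => /complexI. Qed.

Lemma cabsC z : cabs z^* = cabs z.
Proof. by have := norm_conjC z; rewrite !normr_cabs => /complexI. Qed.

Lemma cabsBC z w : cabs (z - w) = cabs (w - z).
Proof. by rewrite -cabsN opprB. Qed.

Lemma cabs_real (x : R) : cabs (x%:C%C) = `|x|.
Proof. by rewrite /cabs /= expr0n addr0 sqrtr_sqr. Qed.

Lemma cabs_prod (I : Type) (r : seq I) (P : pred I) (F : I -> R[i]) :
  cabs (\prod_(i <- r | P i) F i) = \prod_(i <- r | P i) cabs (F i).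
Proof.
elim/big_ind2: _ => [|x1 x2 y1 y2 <- <-|//]; first exact: cabs1.
by rewrite cabsM.
Qed.

Lemma cabs_sum (I : Type) (r : seq I) (P : pred I) (F : I -> R[i]) :
  cabs (\sum_(i <- r | P i) F i) <= \sum_(i <- r | P i) cabs (F i).
Proof.
elim/big_ind2: _ => [|x1 x2 y1 y2 h1 h2|//]; first by rewrite cabs0.
by apply: (le_trans (cabsD _ _)); apply: lerD.
Qed.

Lemma cabs_sign b : cabs ((-1) ^+ nat_of_bool b : R[i]) = 1.
Proof. by case: b; rewrite ?expr1 ?cabsN ?expr0 cabs1. Qed.

End Modulus.

(** * The entrywise norm *)

(** The sum of the moduli of the entries is submultiplicative for rectangular
    matrices and additive on blocks, which suits the induction on the size; it
    is equivalent to the operator norm for each size. *)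
Definition enorm (R : realType) m n (A : 'M[R[i]]_(m, n)) : R :=
  \sum_i \sum_j cabs (A i j).

Section EntrywiseNorm.
Context {R : realType}.

Lemma enorm_ge0 m n (A : 'M[R[i]]_(m, n)) : 0 <= enorm A.
Proof. by apply: sumr_ge0 => i _; apply: sumr_ge0 => j _; apply: cabs_ge0. Qed.

Lemma cabs_le_enorm m n (A : 'M[R[i]]_(m, n)) i j : cabs (A i j) <= enorm A.
Proof.
rewrite /enorm (bigD1 i) //= (bigD1 j) //= -addrA lerDl.
rewrite addr_ge0 ?sumr_ge0 // => k _; first exact: cabs_ge0.
by apply: sumr_ge0 => l _; apply: cabs_ge0.
Qed.

Lemma enorm_eq0 m n (A : 'M[R[i]]_(m, n)) : enorm A = 0 -> A = 0.
Proof.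
move=> A0; apply/matrixP => i j; rewrite mxE; apply/eqP.
by rewrite -cabs_eq0 eq_le cabs_ge0 andbT -A0 cabs_le_enorm.
Qed.

Lemma enorm0 m n : enorm (0 : 'M[R[i]]_(m, n)) = 0.
Proof.
by rewrite /enorm big1 // => i _; rewrite big1 // => j _; rewrite mxE cabs0.
Qed.

Lemma enormD m n (A B : 'M[R[i]]_(m, n)) : enorm (A + B) <= enorm A + enorm B.
Proof.
rewrite /enorm -big_split; apply: ler_sum => i _ /=.
by rewrite -big_split; apply: ler_sum => j _ /=; rewrite mxE cabsD.
Qed.

Lemma enormN m n (A : 'M[R[i]]_(m, n)) : enorm (- A) = enorm A.
Proof. by apply: eq_bigr => i _; apply: eq_bigr => j _; rewrite mxE cabsN. Qed.

Lemma enormBC m n (A B : 'M[R[i]]_(m, n)) : enorm (A - B) = enorm (B - A).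
Proof. by rewrite -enormN opprB. Qed.

Lemma enormZ m n a (A : 'M[R[i]]_(m, n)) : enorm (a *: A) = cabs a * enorm A.
Proof.
rewrite /enorm mulr_sumr; apply: eq_bigr => i _; rewrite mulr_sumr.
by apply: eq_bigr => j _; rewrite mxE cabsM.
Qed.

Lemma enormM m n p (A : 'M[R[i]]_(m, n)) (B : 'M[R[i]]_(n, p)) :
  enorm (A *m B) <= enorm A * enorm B.
Proof.
rewrite {1 2}/enorm mulr_suml; apply: ler_sum => i _.
apply: (@le_trans _ _ (\sum_k \sum_j cabs (A i j) * cabs (B j k))).
  apply: ler_sum => k _; rewrite mxE; apply: (le_trans (cabs_sum _ _ _)).
  by apply: ler_sum => j _; rewrite cabsM.
rewrite exchange_big mulr_suml; apply: ler_sum => j _ /=.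
rewrite -mulr_sumr; apply: ler_wpM2l; first exact: cabs_ge0.
rewrite /enorm (bigD1 j) //= lerDl.
by apply: sumr_ge0 => k _; apply: sumr_ge0 => l _; apply: cabs_ge0.
Qed.

Lemma enorm_adj m n (A : 'M[R[i]]_(m, n)) : enorm (A^t*) = enorm A.
Proof.
rewrite /enorm exchange_big /=; apply: eq_bigr => i _; apply: eq_bigr => j _.
by rewrite !mxE cabsC.
Qed.

Lemma enorm_block m1 m2 n1 n2 (A : 'M[R[i]]_(m1, n1)) (B : 'M[R[i]]_(m1, n2))
    (C : 'M[R[i]]_(m2, n1)) (D : 'M[R[i]]_(m2, n2)) :
  enorm (block_mx A B C D) = enorm A + enorm B + (enorm C + enorm D).
Proof.
rewrite /enorm big_split_ord /= -!big_split /=; congr (_ + _);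
  apply: eq_bigr => i _; rewrite big_split_ord /=; congr (_ + _);
  by apply: eq_bigr => j _;
    rewrite ?block_mxEul ?block_mxEur ?block_mxEdl ?block_mxEdr.
Qed.

Lemma enorm_col_mx m1 m2 n (A : 'M[R[i]]_(m1, n)) (B : 'M[R[i]]_(m2, n)) :
  enorm (col_mx A B) = enorm A + enorm B.
Proof.
rewrite /enorm big_split_ord /=; congr (_ + _); apply: eq_bigr => i _;
  by apply: eq_bigr => j _; rewrite ?col_mxEu ?col_mxEd.
Qed.

Lemma enorm_scalar n (a : R[i]) : enorm (a%:M : 'M[R[i]]_n) = n%:R * cabs a.
Proof.
rewrite /enorm (eq_bigr (fun=> cabs a)) ?sumr_const ?card_ord ?mulr_natl // => i _.
rewrite (bigD1 i) //= big1 ?addr0 ?mxE ?eqxx // => j /negPf ji.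
by rewrite mxE eq_sym ji cabs0.
Qed.

Lemma enorm_unitary n (U : 'M[R[i]]_n) :
  U \is unitarymx -> enorm U <= n%:R ^+ 2.
Proof.
move=> /unitarymxP /matrixP UU.
have U1 i j : cabs (U i j) <= 1.
  have := UU i i; rewrite !mxE eqxx => /eqP.
  under eq_bigr do rewrite !mxE -normCK normr_cabs -rmorphXn.
  rewrite -rmorph_sum -(rmorph1 (real_complex R)) => /eqP/complexI s1.
  have: cabs (U i j) ^+ 2 <= 1.
    by rewrite -s1 (bigD1 j) //= lerDl sumr_ge0 // => k _; apply: sqr_ge0.
  by rewrite expr_le1 // cabs_ge0.
apply: (@le_trans _ _ (\sum_(i < n) \sum_(j < n) 1)).
  by apply: ler_sum => i _; apply: ler_sum => j _.
by rewrite !sumr_const !card_ord -mulrnA expr2 -natrM.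
Qed.

Lemma enorm_scalar1 (x : R[i]) : enorm (x%:M : 'M[R[i]]_1) = cabs x.
Proof. by rewrite enorm_scalar mul1r. Qed.

End EntrywiseNorm.

(** * Inverses up to rank one *)

(** A left inverse modulo matrices of rank at most 1.  Such a G exists exactly
    when M has corank at most 1, and its norm measures how robustly it does:
    the second smallest singular value of M is bounded below in terms of it. *)
Definition left_quasi_inverse (F : fieldType) n (G M : 'M[F]_n) : Prop :=
  exists (a : 'cV[F]_n) (b : 'rV[F]_n), G *m M = 1%:M - a *m b.

Section QuasiInverse.
Context {F : fieldType}.

Lemma rank_le1 m n (A : 'M[F]_(m, n)) :
  (\rank A <= 1)%N -> exists (a : 'cV[F]_m) (b : 'rV[F]_n), A = a *m b.
Proof.
move: (col_base A) (row_base A) (mulmx_base A).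
case: (\rank A) => [|[|//]] a b def_A _; last by exists a, b.
by exists 0, 0; rewrite mulmx0 -def_A thinmx0 mul0mx.
Qed.

Lemma left_quasi_inverse_exists n (M : 'M[F]_n) :
  (n <= (\rank M).+1)%N -> exists G, left_quasi_inverse G M.
Proof.
move=> rM; exists (invmx (row_ebase M) *m invmx (col_ebase M)).
have GM : invmx (row_ebase M) *m invmx (col_ebase M) *m M
    = 1%:M - invmx (row_ebase M) *m copid_mx (\rank M) *m row_ebase M.
  rewrite -{3}[M]mulmx_ebase !mulmxA mulmxKV ?col_ebase_unit //.
  rewrite /copid_mx mulmxBr mulmxBl mulmx1 mulVmx ?row_ebase_unit //.
  by rewrite opprB addrC subrK.
set X := _ *m copid_mx _ *m _ in GM.
have [|a [b ab]] := @rank_le1 _ _ X.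
  rewrite mxrankMfree ?row_free_unit ?row_ebase_unit //.
  apply: (leq_trans (mxrankM_maxr _ _)).
  by rewrite rank_copid_mx ?rank_leq_row // leq_subLR addn1.
by exists a, b; rewrite GM ab.
Qed.

(** With G = [g, h; k, H] and a b = [a1 b1, a1 b2; a2 b1, a2 b2], the bottom
    row of the equation reads k m = - a2 b1 and k r + H M = 1 - a2 b2.  If
    m <> 0 the first identity turns k r into a multiple of a2, and if m = 0 it
    forces a2 = 0; in both cases H M is 1 minus one rank one term.  Taking a
    block does not increase the norm of the quasi-inverse, so that the same
    bound serves at all stages of a deflation. *)
Lemma left_quasi_inverse_drsubmx n (G : 'M[F]_(1 + n)) m
    (r : 'rV[F]_n) (M : 'M[F]_n) :
  left_quasi_inverse G (block_mx m r 0 M : 'M[F]_(1 + n)) ->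
  left_quasi_inverse (drsubmx G) M.
Proof.
move=> [a [b]].
rewrite -[G in LHS]submxK -[a]vsubmxK -[b]hsubmxK mul_col_row scalar_mx_block.
rewrite opp_block_mx add_block_mx mulmx_block !mulmx0 !addr0 !add0r.
set g := ulsubmx G; set k := dlsubmx G; set H := drsubmx G.
set a1 := usubmx a; set a2 := dsubmx a; set b1 := lsubmx b; set b2 := rsubmx b.
move=> /eq_block_mx [gm _ km HM].
have a1b1 : a1 *m b1 = 1%:M - g *m m by rewrite gm opprB addrC subrK.
have HM' : H *m M = 1%:M - (a2 *m b2 + k *m r).
  by rewrite opprD addrA -HM addrC addKr.
have [m0|m0] := eqVneq m 0.
  have a2b1 : a2 *m b1 = 0 by apply/eqP; rewrite -oppr_eq0 -km m0 mulmx0.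
  have a20 : a2 = 0.
    (* a1 and b1 are 1 x 1, hence commute, and a1 b1 = 1 here *)
    rewrite -[a2]mulmx1 -[1%:M](_ : b1 *m a1 = _) ?mulmxA ?a2b1 ?mul0mx //.
    have := a1b1; rewrite m0 mulmx0 subr0 => <-.
    by rewrite [a1]mx11_scalar [b1]mx11_scalar -!scalar_mxM mulrC.
  by exists k, r; rewrite HM' a20 mul0mx add0r.
have mu : m \in unitmx by rewrite unitmxE [m]mx11_scalar det_scalar1 unitfE;
  apply: contra m0 => /eqP m00; rewrite [m]mx11_scalar m00 raddf0.
exists a2, (b2 - b1 *m invmx m *m r); rewrite HM' mulmxBr; congr (_ - (_ + _)).
by rewrite -[k](mulmxK mu) km !mulNmx !mulmxA.
Qed.

Lemma left_quasi_inverse_conj n (G M P Q : 'M[F]_n) :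
  P *m Q = 1%:M -> left_quasi_inverse G M ->
  left_quasi_inverse (Q *m G *m P) (Q *m M *m P).
Proof.
move=> PQ [a [b GM]]; exists (Q *m a), (b *m P).
have -> : Q *m G *m P *m (Q *m M *m P) = Q *m (G *m M) *m P.
  by rewrite !mulmxA -[_ *m P *m Q]mulmxA PQ mulmx1.
by rewrite GM mulmxBr mulmxBl mulmx1 !mulmxA (mulmx1C PQ).
Qed.

End QuasiInverse.

(** The first basis vector e lies in the kernel of T, so applying G T = 1 - a b
    to it shows that a is proportional to e.  Below the first entry the vectors
    x and G T x therefore agree. *)
Lemma left_quasi_inverse_bound (R : realType) n (G : 'M[R[i]]_(1 + n))
    (r : 'rV[R[i]]_n) (M : 'M[R[i]]_n) (x : 'cV[R[i]]_(1 + n))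
    (T := block_mx 0 r 0 M : 'M[R[i]]_(1 + n)) :
  left_quasi_inverse G T -> enorm (dsubmx x) <= enorm G * enorm (T *m x).
Proof.
move=> [a [b GT]].
pose e : 'cV[R[i]]_(1 + n) := col_mx 1%:M 0.
have Te : T *m e = 0.
  by rewrite /T mul_block_col !(mul0mx, mulmx0) !addr0 col_mx0.
have ab : a *m (b *m e) = e.
  have : G *m T *m e = 0 by rewrite -mulmxA Te mulmx0.
  by rewrite GT mulmxBl mul1mx mulmxA => /eqP; rewrite subr_eq0 => /eqP <-.
have a2 : dsubmx a = 0.
  move: ab; move: (b *m _) => c.
  rewrite -[a in LHS]vsubmxK mul_col_mx => /eq_col_mx [a1c a2b].
  rewrite -[dsubmx a]mulmx1 -[1%:M](_ : c *m usubmx a = _).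
    by rewrite mulmxA a2b mul0mx.
  by rewrite -a1c [c]mx11_scalar [usubmx a]mx11_scalar -!scalar_mxM mulrC.
have -> : dsubmx x = dsubmx (G *m (T *m x)).
  rewrite mulmxA GT mulmxBl mul1mx linearB /= -mulmxA -mul_dsub_mx a2.
  by rewrite mul0mx subr0.
apply: le_trans (enormM _ _).
by rewrite -[X in _ <= enorm X]vsubmxK enorm_col_mx lerDr enorm_ge0.
Qed.

(** * Corank of a non-derogatory matrix *)

Section Nonderogatory.
Context {R : realType}.

Lemma jordan_block_subC m (lam a : R[i]) :
  jordan_block m lam - a%:M = jordan_block m (lam - a).
Proof.
by apply/matrixP => k l; rewrite !mxE mulrnBl addrAC.
Qed.

Lemma rank_jordan_block m (lam : R[i]) :
  lam != 0 -> \rank (jordan_block m lam) = m.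
Proof.
move=> lam0; apply/mxrank_unit; rewrite -unitmx_tr unitmxE det_trig.
  rewrite unitfE; apply/prodf_neq0 => i _.
  by rewrite !mxE eqxx gtn_eqF ?addr0.
apply/is_trig_mxP => i j ij; rewrite !mxE.
rewrite -(inj_eq val_inj) /= (gtn_eqF ij) [j.+1 == i]gtn_eqF ?addr0 //.
by rewrite ltnS ltnW.
Qed.

(** For the nilpotent block N, the product N N^T is the identity with its last
    diagonal entry erased. *)
Lemma rank_jordan_block0 m : (m <= (\rank (jordan_block m (0%R : R[i]))).+1)%N.
Proof.
case: m => [//|m]; set N := jordan_block _ _.
have NN : 1%:M = N *m N^T + delta_mx ord_max ord_max.
  apply/matrixP => i j; rewrite !mxE.
  under eq_bigr do rewrite !mxE !mul0rn !add0r -natrM mulnb.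
  have [ij|ij] := eqVneq i j; last first.
    rewrite big1 => [|k _]; last first.
      case: eqP => //= <-; rewrite eqSS eq_sym.
      by rewrite (inj_eq val_inj) (negPf ij).
    rewrite add0r; case: eqP => //= im; case: eqP => //= jm.
    by rewrite im jm eqxx in ij.
  rewrite -{j}ij andbb; under eq_bigr do rewrite andbb.
  have [im|im] := eqVneq i ord_max.
    rewrite big1 ?add0r // => k _; rewrite im /=.
    by rewrite gtn_eqF.
  have im' : (i.+1 < m.+1)%N.
    rewrite ltnS ltn_neqAle -ltnS ltn_ord andbT.
    by move: im; rewrite -(inj_eq val_inj).
  rewrite (bigD1 (Ordinal im')) //= eqxx big1 ?addr0 // => k.
  by rewrite -(inj_eq val_inj) /= eq_sym => /negPf ->.
have := mxrank_add (N *m N^T) (delta_mx ord_max ord_max).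
rewrite -NN mxrank1 mxrank_delta addn1 => h; apply: (leq_trans h).
by rewrite ltnS mxrankM_maxl.
Qed.

(** Distinct Jordan blocks have distinct eigenvalues, so at most one of them
    becomes singular when a is subtracted, and it loses one dimension. *)
Lemma nonderogatory_rank n (A : 'M[R[i]]_n) (a : R[i]) :
  nonderogatory A -> (n <= (\rank (A - a%:M)%R).+1)%N.
Proof.
move=> [r [p [lam [[_ [e [P Pu /(similarRL Pu) J]]] lam_inj]]]].
have -> : \rank (A - a%:M)
    = (\sum_k \rank (jordan_block (p k) (lam k - a)%R))%N.
  transitivity (\rank (P *m (A - a%:M) *m invmx P)).
    rewrite mxrankMfree ?row_free_unit ?unitmx_inv //.
    by rewrite eqmxMfull // row_full_unit.
  rewrite mulmxBr mulmxBl -J scalar_mxC mulmxK //.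
  have rank_cast N N' (eN : N = N') (B : 'M[R[i]]_N) :
      \rank (castmx (eN, eN) B - a%:M) = \rank (B - a%:M).
    by case: _ / eN; rewrite castmx_id.
  rewrite rank_cast -mxdiagZ -mxdiagB rank_mxdiag.
  by apply: eq_bigr => k _; rewrite jordan_block_subC.
rewrite -{1}e.
have [k /eqP ka|nok] := pickP (fun k => lam k == a); last first.
  apply: leqW; apply: leq_sum => k _; rewrite rank_jordan_block //.
  by rewrite subr_eq0 nok.
rewrite (bigD1 k) //= [X in (_ <= X.+1)%N](bigD1 k) //= -addSn.
apply: leq_add; first by rewrite ka subrr rank_jordan_block0.
apply: leq_sum => l lk; rewrite rank_jordan_block // subr_eq0 -ka.
by apply: contra lk => /eqP/lam_inj ->.
Qed.

End Nonderogatory.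

(** * The determinant and eigenvalues near a given point *)

Section Determinant.
Context {R : realType}.

(** The telescoping identity x X - y Y = (x - y) X + y (X - Y), iterated. *)
Lemma prod_lipschitz (I : Type) (r : seq I) (M : R) (F G : I -> R[i]) :
  1 <= M -> (forall i, cabs (F i) <= M) -> (forall i, cabs (G i) <= M) ->
  cabs (\prod_(i <- r) F i - \prod_(i <- r) G i)
    <= M ^+ size r * \sum_(i <- r) cabs (F i - G i).
Proof.
move=> M1 FM GM; have M0 := le_trans ler01 M1.
have prodM s : cabs (\prod_(i <- s) F i) <= M ^+ size s.
  elim: s => [|i s IHs]; first by rewrite big_nil cabs1.
  by rewrite big_cons cabsM exprS ler_pM ?cabs_ge0.
elim: r => [|i r IHr]; first by rewrite !big_nil subrr cabs0 mulr0.
rewrite !big_cons.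
have -> : F i * \prod_(j <- r) F j - G i * \prod_(j <- r) G j
  = (F i - G i) * \prod_(j <- r) F j
    + G i * (\prod_(j <- r) F j - \prod_(j <- r) G j) by ring.
apply: (le_trans (cabsD _ _)); rewrite !cabsM mulrDr /= exprS.
apply: lerD.
  rewrite mulrC; apply: ler_wpM2r; first exact: cabs_ge0.
  apply: (le_trans (prodM r)); rewrite ler_peMl // exprn_ge0 //.
by rewrite -mulrA; apply: ler_pM; rewrite ?cabs_ge0.
Qed.

Lemma det_lipschitz n (M : R) (A B : 'M[R[i]]_n) :
  1 <= M -> enorm A <= M -> enorm B <= M ->
  cabs (\det A - \det B) <= #|{perm 'I_n}|%:R * M ^+ n * enorm (A - B).
Proof.
move=> M1 AM BM; rewrite /determinant -sumrB.
apply: (le_trans (cabs_sum _ _ _)).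
rewrite -mulrA mulr_natl -sumr_const; apply: ler_sum => s _.
rewrite -mulrBr cabsM cabs_sign mul1r.
have size_n : size (index_enum 'I_n) = n.
  by rewrite -[RHS](card_ord n) cardT enumT.
apply: le_trans (prod_lipschitz _ M1 _ _) _.
- by move=> i; apply: le_trans (cabs_le_enorm _ _ _) AM.
- by move=> i; apply: le_trans (cabs_le_enorm _ _ _) BM.
rewrite size_n; apply: ler_wpM2l; first by rewrite exprn_ge0 // (le_trans ler01).
(* the permutation s selects one entry of A - B in each row *)
apply: ler_sum => i _.
rewrite (bigD1 (s i)) //= !mxE lerDl sumr_ge0 // => j _; exact: cabs_ge0.
Qed.

Lemma horner_char_poly n (A : 'M[R[i]]_n) a :
  (char_poly A).[a] = \det (a%:M - A).
Proof.
rewrite -horner_evalE -det_map_mx; congr (\det _); apply/matrixP => i j.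
by rewrite !mxE /= /horner_eval !(hornerE, hornerMn).
Qed.

(** The determinant is the product of the n differences between a and the
    eigenvalues; if all of them exceeded rho in modulus, it would exceed
    rho ^+ n. *)
Lemma eigenvalue_near n (B : 'M[R[i]]_n) a (rho : R) :
  (0 < n)%N -> 0 <= rho -> cabs (\det (a%:M - B)) <= rho ^+ n ->
  exists2 mu, cabs (mu - a) <= rho & \det (mu%:M - B) = 0.
Proof.
move=> n0 rho0; rewrite -horner_char_poly.
have [rs] := closed_field_poly_normal (char_poly B).
rewrite (monicP (char_poly_monic B)) scale1r => rsE.
have size_rs : size rs = n.
  by have := size_char_poly B; rewrite rsE size_prod_XsubC => -[].
have horner_rs x : (char_poly B).[x] = \prod_(z <- rs) (x - z).
  by rewrite rsE horner_prod; apply: eq_bigr => z _; rewrite hornerXsubC.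
move=> le_rho.
have [/hasP [z zrs zrho]|/hasPn far] :=
  boolP (has (fun z => cabs (z - a) <= rho) rs).
  exists z => //; rewrite -horner_char_poly horner_rs.
  apply/eqP; rewrite prodf_seq_eq0; apply/hasP.
  by exists z => //=; rewrite subrr.
move: le_rho; rewrite horner_rs cabs_prod leNgt => /negP[].
rewrite -size_rs; have {n0} : rs != [::] by rewrite -size_eq0 size_rs -lt0n.
elim: rs far {rsE size_rs horner_rs} => [//|z rs IHrs] far _.
have zfar : rho < cabs (a - z) by rewrite cabsBC ltNge far ?mem_head.
rewrite big_cons exprS; have [->|rs0] := eqVneq rs [::].
  by rewrite expr0 big_nil !mulr1.
apply: ltr_pM => //; first exact: exprn_ge0.
by apply: IHrs => // w wrs; rewrite far // inE wrs orbT.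
Qed.

End Determinant.

(** * A unitary matrix near the identity with prescribed first column *)

Section UnitaryCompletion.
Context {R : realType}.

(** Normalise (1, y) to the unit vector (a, b), with a > 0.  The matrix
    [a, - b^*; b, 1 - b b^* / (1 + a)] is the reflection that exchanges (a, b)
    and (-1, 0), composed with a change of sign of the first coordinate.  This
    reflection, rather than the one that exchanges (a, b) and (1, 0), depends
    smoothly on y at y = 0. *)
Lemma unitary_completion n (y : 'cV[R[i]]_n) :
  exists (W : 'M[R[i]]_(1 + n)) (c : R[i]), [/\ W \is unitarymx,
    W *m (col_mx 1%:M 0 : 'cV[R[i]]_(1 + n))
      = c *: (col_mx 1%:M y : 'cV[R[i]]_(1 + n)) &
    enorm (W - 1%:M) <= 2 * enorm y * (1 + enorm y)].
Proof.
pose s : R := \sum_i cabs (y i 0) ^+ 2.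
pose a : R := (Num.sqrt (1 + s))^-1.
have s0 : 0 <= s by apply: sumr_ge0 => i _; apply: sqr_ge0.
have s1 : 0 < 1 + s by rewrite ltr_pwDl.
have a0 : 0 < a by rewrite invr_gt0 sqrtr_gt0.
have a2 : a ^+ 2 * (1 + s) = 1.
  by rewrite exprVn sqr_sqrtr ?mulVf ?gt_eqF // ltW.
have sle : s <= enorm y ^+ 2.
  rewrite /s /enorm expr2 mulr_suml; apply: ler_sum => i _.
  rewrite big_ord1 expr2.
  apply: ler_wpM2l; first exact: cabs_ge0.
  by have := cabs_le_enorm y i 0; rewrite /enorm.
have ac : (a%:C%C)^* = a%:C%C :> R[i].
  by apply: conj_Creal; rewrite ger0_real // lecR ltW.
pose k : R := (1 + a)^-1.
have ka : k * (1 + a) = 1 by rewrite mulVf // gt_eqF // addr_gt0.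
have k0 : 0 < k by rewrite invr_gt0 addr_gt0.
have kc : (k%:C%C)^* = k%:C%C :> R[i].
  by apply: conj_Creal; rewrite ger0_real // lecR ltW.
pose b : 'cV[R[i]]_n := a%:C%C *: y.
have yy : y^t* *m y = (s%:C%C)%:M.
  apply/matrixP => i j; rewrite !ord1 !mxE eqxx mulr1n rmorph_sum /=.
  apply: eq_bigr => l _; rewrite !mxE mulrC -normCK normr_cabs -rmorphXn.
  by [].
have bE : b = a%:C%C *: y by [].
have badj : b^t* = a%:C%C *: y^t*.
  by apply/matrixP => i j; rewrite !mxE rmorphM /= ac.
have bb : b^t* *m b = ((1 - a ^+ 2)%:C%C)%:M.
  rewrite badj /b -scalemxAl -scalemxAr yy !scale_scalar_mx -!rmorphM.
  by congr ((_%:C%C)%:M); rewrite -a2; ring.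
pose H : 'M[R[i]]_n := 1%:M - k%:C%C *: (b *m b^t*).
have bH : b^t* *m H = a%:C%C *: b^t*.
  rewrite /H mulmxBr mulmx1 -scalemxAr mulmxA bb mul_scalar_mx scalerA -rmorphM.
  rewrite -{1}[b^t*]scale1r -scalerBl -(rmorph1 (real_complex R)) -rmorphB /=.
  congr (_%:C%C *: _).
  transitivity (1 - k * (1 + a) * (1 - a)); first by ring.
  by rewrite ka; ring.
have Hadj : H^t* = H.
  rewrite /H linearB /= map_mxB trmx1 map_mx1 linearZ /= map_mxZ /= kc.
  by rewrite trmx_mul map_mxM -map_trmx trmxK map_mxCK.
have Hb : H *m b = a%:C%C *: b.
  rewrite /H mulmxBl mul1mx -scalemxAl -mulmxA bb mul_mx_scalar scalerA -rmorphM.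
  rewrite -{1}[b]scale1r -scalerBl -(rmorph1 (real_complex R)) -rmorphB /=.
  congr (_%:C%C *: _).
  transitivity (1 - k * (1 + a) * (1 - a)); first by ring.
  by rewrite ka; ring.
have HE : H = 1%:M - k%:C%C *: (b *m b^t*) by [].
clearbody H b.
have HH : b *m b^t* + H *m H = 1%:M.
  rewrite {1}HE mulmxBl mul1mx -scalemxAl -mulmxA bH -scalemxAr scalerA HE.
  rewrite addrCA -addrA -[RHS]addr0; congr (_ + _).
  rewrite -{2}[b *m b^t*]scale1r -scalerBl -scaleNr -scalerDl.
  rewrite -(rmorph1 (real_complex R)) -rmorphM -rmorphB -rmorphN -rmorphD /=.
  have -> : - k + (1 - k * a) = 1 - k * (1 + a) by ring.
  by rewrite ka subrr scale0r.
have aadj : (a%:C%C)%:M^t* = (a%:C%C)%:M :> 'M[R[i]]_1.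
  by rewrite tr_scalar_mx map_scalar_mx /= ac.
have badj2 : (- b^t*)^t* = - b.
  by apply/matrixP => i j; rewrite !mxE rmorphN /= conjCK.
exists (block_mx (a%:C%C)%:M (- b^t*) b H), a%:C%C; split.
- apply/unitarymxP; rewrite tr_block_mx map_block_mx Hadj aadj badj2.
  rewrite mulmx_block mulNmx mulmxN opprK bb mulNmx bH mulmxN Hb HH.
  rewrite mul_scalar_mx mul_mx_scalar !(subrr, addNr) scale_scalar_mx.
  rewrite -raddfD /= scalar_mx_block.
  by rewrite -rmorphM -rmorphD /= -expr2 addrC subrK mul_scalar_mx subrr.
- rewrite mul_block_col !mulmx1 !mulmx0 !addr0 scale_col_mx.
  by rewrite scalemx1 bE.
rewrite scalar_mx_block opp_block_mx add_block_mx !oppr0 !addr0 enorm_block.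
rewrite -raddfB /= enorm_scalar1 enormN enorm_adj.
have -> : H - 1%:M = - (k%:C%C *: (b *m b^t*)) by rewrite HE addrC addKr.
have -> : cabs (a%:C%C - 1) = `|a - 1|.
  by rewrite -cabs_real rmorphB rmorph1.
rewrite enormN enormZ cabs_real [`|k|]gtr0_norm //.
have a2s : 0 <= a ^+ 2 * s by rewrite mulr_ge0 // sqr_ge0.
have a_le1 : a <= 1.
  by rewrite -(@expr_le1 _ 2 a) ?(ltW a0) // -[leRHS]a2 mulrDr mulr1 lerDl.
have b_y : enorm b <= enorm y.
  by rewrite bE enormZ cabs_real gtr0_norm // ler_piMl ?enorm_ge0.
have bb_y : k * enorm (b *m b^t*) <= enorm y ^+ 2.
  apply: (@le_trans _ _ (enorm (b *m b^t*))).
    rewrite ler_piMl ?enorm_ge0 // -ka ler_peMr ?(ltW k0) //; lra.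
  apply: (le_trans (enormM _ _)); rewrite enorm_adj -expr2.
  by rewrite ler_pXn2r ?nnegrE ?enorm_ge0.
(* 1 - a <= 1 - a ^+ 2 = a ^+ 2 * s <= s *)
have a1 : `|a - 1| <= enorm y ^+ 2.
  apply: le_trans sle; rewrite ler0_norm ?subr_le0 //.
  have : 0 <= a * (1 - a) by rewrite mulr_ge0 ?subr_ge0 // ltW.
  rewrite mulrBr mulr1 -expr2 => aa.
  have : 0 <= s * (1 - a ^+ 2).
    by rewrite mulr_ge0 // subr_ge0 expr_le1 // (ltW a0).
  rewrite mulrBr mulr1 [s * _]mulrC.
  move: a2; rewrite mulrDr mulr1; lra.
rewrite mulrDr mulr1 -mulrA -expr2. lra.
Qed.

End UnitaryCompletion.

(** * Splitting off one eigenvalue *)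

Section Deflation.
Context {R : realType}.

Lemma unitarymx_mulVmx n (U : 'M[R[i]]_n) : U \is unitarymx -> U^t* *m U = 1%:M.
Proof. by move=> /unitarymxP; apply: mulmx1C. Qed.

(** U^* B U - B = (U - 1)^* B U + B (U - 1).  Thus closeness of the unitary
    factors is the only thing to control; closeness of the triangular factors
    follows. *)
Lemma unitary_conj_near n (U B : 'M[R[i]]_n) : U \is unitarymx ->
  enorm (U^t* *m B *m U - B) <= (n%:R ^+ 2 + 1) * enorm (U - 1%:M) * enorm B.
Proof.
move=> Uu.
have -> : U^t* *m B *m U - B = (U - 1%:M)^t* *m B *m U + B *m (U - 1%:M).
  rewrite linearB /= map_mxB trmx1 map_mx1 !mulmxBl mul1mx mulmxBr mulmx1.
  by rewrite addrA subrK.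
apply: (le_trans (enormD _ _)).
have -> : (n%:R ^+ 2 + 1) * enorm (U - 1%:M) * enorm B
  = enorm (U - 1%:M) * enorm B * n%:R ^+ 2 + enorm B * enorm (U - 1%:M) by ring.
apply: lerD; last exact: enormM.
apply: (le_trans (enormM _ _)).
apply: ler_pM; rewrite ?enorm_ge0 ?enorm_unitary //.
by apply: (le_trans (enormM _ _)); rewrite enorm_adj.
Qed.

Lemma singular_kernel n (M : 'M[R[i]]_n) :
  \det M = 0 -> exists2 v : 'cV[R[i]]_n, v != 0 & M *m v = 0.
Proof.
move=> /eqP; rewrite -det_tr => /det0P [v v0 vM]; exists v^T.
  by apply: contra v0 => /eqP v0; rewrite -[v]trmxK v0 trmx0.
by rewrite -[M]trmxK -trmx_mul vM trmx0.
Qed.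

(** An eigenvector v of B for mu is almost in the kernel of T - l0, since
    (T - l0) v = (mu - l0) v - (B - T) v.  The quasi-inverse bounds its lower
    part by C d times its norm; for C d <= 1/2 its first entry dominates and
    can be normalised to 1. *)
Lemma eigenvector_near n (C : R) (G : 'M[R[i]]_(1 + n)) l0
    (r0 : 'rV[R[i]]_n) (T0 : 'M[R[i]]_n) (B : 'M[R[i]]_(1 + n)) mu
    (T := block_mx l0%:M r0 0 T0)
    (d := enorm (B - T) + cabs (mu - l0)) :
  left_quasi_inverse G (T - l0%:M) -> enorm G <= C -> C * d <= 2^-1 ->
  \det (mu%:M - B) = 0 ->
  exists2 y : 'cV[R[i]]_n, enorm y <= 2 * C * d &
    B *m col_mx 1%:M y = mu *: col_mx 1%:M y :> 'cV[R[i]]_(1 + n).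
Proof.
move=> GT GC Cd /singular_kernel [v v0].
rewrite mulmxBl mul_scalar_mx => /subr0_eq Bv.
have d0 : 0 <= d by rewrite addr_ge0 ?enorm_ge0 ?cabs_ge0.
have Tv : enorm ((T - l0%:M) *m v) <= d * enorm v.
  have -> : (T - l0%:M) *m v = (mu - l0) *: v - (B - T) *m v.
    by rewrite !mulmxBl mul_scalar_mx scalerBl -Bv opprB [RHS]addrC addrA subrK.
  apply: (le_trans (enormD _ _)); rewrite enormN enormZ /d mulrDl addrC lerD2r.
  exact: enormM.
have v2 : enorm (dsubmx v) <= C * d * enorm v.
  rewrite /T scalar_mx_block opp_block_mx add_block_mx subrr !subr0 in GT Tv *.
  apply: (le_trans (left_quasi_inverse_bound v GT)).
  by rewrite -mulrA; apply: ler_pM; rewrite ?enorm_ge0.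
have v1E : usubmx v = (v 0 0)%:M.
  rewrite [usubmx v]mx11_scalar; congr (_%:M); rewrite mxE.
  by congr (v _ _); apply/val_inj.
have vN : enorm v = cabs (v 0 0) + enorm (dsubmx v).
  by rewrite -{1}[v]vsubmxK enorm_col_mx v1E enorm_scalar1.
have v2' : enorm (dsubmx v) <= 2 * C * d * cabs (v 0 0).
  rewrite vN in v2.
  have := @ler_wpM2r _ _ (enorm_ge0 (dsubmx v)) _ _ Cd.
  lra.
have v1 : v 0 0 != 0.
  apply: contra v0 => /eqP v10; rewrite -[v]vsubmxK v1E v10 raddf0.
  have : enorm (dsubmx v) = 0.
    by apply/eqP; rewrite eq_le enorm_ge0 andbT; rewrite v10 cabs0 mulr0 in v2'.
  by move=> /enorm_eq0 ->; rewrite col_mx0.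
have vE : v = v 0 0 *:
    (col_mx 1%:M ((v 0 0)^-1 *: dsubmx v) : 'cV[R[i]]_(1 + n)).
  by rewrite -{1}[v]vsubmxK scale_col_mx scalerA divff // scale1r v1E scalemx1.
exists ((v 0 0)^-1 *: dsubmx v).
  rewrite enormZ cabsV mulrC ler_pdivrMr //.
  by rewrite lt_neqAle cabs_ge0 andbT eq_sym cabs_eq0.
apply: (scalerI v1).
by rewrite scalemxAr -vE scalerA [v 0 0 * mu]mulrC -scalerA -vE Bv.
Qed.

(** Conjugation by the unitary completion of the nearby eigenvector.  The
    constants depend on C and M but not on T0, which is what makes the final
    constants uniform over all Schur forms of one matrix. *)
Lemma schur_deflation n (C M : R) : 0 <= C -> 0 <= M ->
  exists K rho : R, [/\ 0 <= K, 0 < rho &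
  forall (G : 'M[R[i]]_(1 + n)) l0 (r0 : 'rV[R[i]]_n) (T0 : 'M[R[i]]_n)
    (B : 'M[R[i]]_(1 + n)) mu (T := block_mx l0%:M r0 0 T0)
    (d := enorm (B - T) + cabs (mu - l0)),
  left_quasi_inverse G (T - l0%:M) -> enorm G <= C -> enorm T <= M ->
  \det (mu%:M - B) = 0 -> d <= rho ->
  exists (W : 'M[R[i]]_(1 + n)) (r : 'rV[R[i]]_n) (B' : 'M[R[i]]_n),
  [/\ W \is unitarymx, W^t* *m B *m W = block_mx mu%:M r 0 B',
      enorm (W - 1%:M) <= K * d & enorm (B' - T0) <= K * d]].
Proof.
move=> C0 M0.
pose K1 : R := 8 * C; pose K2 : R := ((1 + n)%:R ^+ 2 + 1) * K1 * (M + 1) + 1.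
have n0 : 0 <= (1 + n)%:R ^+ 2 + 1 :> R by rewrite addr_ge0 // exprn_ge0.
have K10 : 0 <= K1 by rewrite mulr_ge0.
have M1 : 0 <= M + 1 by rewrite addr_ge0.
have K20 : 0 <= K2 by rewrite addr_ge0 // !mulr_ge0.
have C1 : 0 < 2 * C + 1 by lra.
exists (K1 + K2), ((2 * C + 1)^-1); split; first exact: addr_ge0.
  by rewrite invr_gt0.
move=> G l0 r0 T0 B mu T d GT GC TM mu_eig d_rho.
have d0 : 0 <= d by rewrite addr_ge0 ?enorm_ge0 ?cabs_ge0.
have dC : d * (2 * C + 1) <= 1 by rewrite -ler_pdivlMr // mul1r.
have Cd : 0 <= C * d by rewrite mulr_ge0.
have [|y yd By] := eigenvector_near GT GC _ mu_eig; rewrite -/T -/d.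
  rewrite -/d; lra.
rewrite -/T -/d in yd By.
have [W [c [Wu We Wy]]] := unitary_completion y.
have W1 : enorm (W - 1%:M) <= K1 * d.
  apply: (le_trans Wy); rewrite /K1.
  have := enorm_ge0 y.
  have : enorm y * enorm y <= enorm y by rewrite ler_piMl ?enorm_ge0 //; lra.
  lra.
pose B1 := W^t* *m B *m W.
have B1e : B1 *m (col_mx 1%:M 0 : 'cV[R[i]]_(1 + n)) = mu *: col_mx 1%:M 0.
  rewrite /B1 -mulmxA We -mulmxA -scalemxAr By scalerA mulrC -scalerA -We.
  by rewrite -scalemxAr mulmxA unitarymx_mulVmx // mul1mx.
have B1E : B1 = block_mx mu%:M (ursubmx B1) 0 (drsubmx B1).
  rewrite -{1}[B1]submxK; move: B1e; rewrite -{1}[B1]submxK mul_block_col.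
  rewrite !mulmx1 !mulmx0 !addr0 scale_col_mx scaler0 scalemx1.
  by move=> /eq_col_mx [-> ->].
exists W, (ursubmx B1), (drsubmx B1); split=> //.
  by apply: (le_trans W1); rewrite mulrDl lerDl mulr_ge0.
have BM : enorm B <= M + 1.
  have -> : B = T + (B - T) by rewrite addrC subrK.
  apply: (le_trans (enormD _ _)); apply: lerD => //.
  apply: (@le_trans _ _ d); first by rewrite lerDl cabs_ge0.
  lra.
have : enorm (B1 - T) <= K2 * d.
  have -> : B1 - T = (B1 - B) + (B - T) by rewrite addrA subrK.
  apply: (le_trans (enormD _ _)); rewrite /K2 mulrDl mul1r; apply: lerD; last first.
    by rewrite lerDl cabs_ge0.
  apply: (le_trans (unitary_conj_near _ Wu)).
  rewrite -!mulrA; apply: ler_wpM2l => //; rewrite mulrA [_ * d]mulrC mulrA.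
  by apply: ler_pM; rewrite ?enorm_ge0 // mulrC.
rewrite {1}B1E /T opp_block_mx add_block_mx enorm_block => B1T.
rewrite mulrDl; apply: (@le_trans _ _ (K2 * d)); last by rewrite lerDr mulr_ge0.
apply: le_trans B1T; rewrite addrA lerDr.
by rewrite !addr_ge0 ?enorm_ge0.
Qed.

End Deflation.

(** * Lipschitz dependence on the matrix and the diagonal *)

(** A quantitative form of being non-derogatory, for upper triangular T, whose
    eigenvalues are its diagonal entries. *)
Definition corank1_bounded (R : realType) (C : R) n (T : 'M[R[i]]_n) : Prop :=
  forall i, exists2 G, enorm G <= C & left_quasi_inverse G (T - (T i i)%:M).

Section SchurPerturbation.
Context {R : realType}.

Lemma upper_triangular_block n m (r : 'rV[R[i]]_n) (T : 'M[R[i]]_n) :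
  upper_triangular (block_mx (m%:M : 'M[R[i]]_1) r 0 T) = upper_triangular T.
Proof.
by rewrite /upper_triangular tr_block_mx trmx0 is_trig_block_mx // eqxx
  tr_scalar_mx scalar_mx_is_trig.
Qed.

Lemma upper_triangularP n (T : 'M[R[i]]_(1 + n)) : upper_triangular T ->
  exists l r (T' : 'M[R[i]]_n), upper_triangular T' /\ T = block_mx l%:M r 0 T'.
Proof.
move=> Tut; exists (ulsubmx T 0 0), (ursubmx T), (drsubmx T).
have TE : T = block_mx (ulsubmx T 0 0)%:M (ursubmx T) 0 (drsubmx T).
  rewrite -{1}[T]submxK -mx11_scalar; congr (block_mx _ _ _ _).
  apply/matrixP => i j; rewrite !ord1 !mxE.
  move: Tut => /is_trig_mxP /(_ (lshift n 0) (rshift 1 i)); rewrite mxE.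
  by apply.
by split=> //; rewrite TE upper_triangular_block in Tut.
Qed.

Lemma sum_diag_block n m1 m2 (r1 r2 : 'rV[R[i]]_n) (T1 T2 : 'M[R[i]]_n) :
  let A := block_mx (m1%:M : 'M[R[i]]_1) r1 0 T1 in
  let B := block_mx (m2%:M : 'M[R[i]]_1) r2 0 T2 in
  \sum_i cabs (A i i - B i i) = cabs (m1 - m2) + \sum_i cabs (T1 i i - T2 i i).
Proof.
rewrite /= big_split_ord big_ord1 /= !block_mxEul !mxE eqxx !mulr1n.
by congr (_ + _); apply: eq_bigr => i _; rewrite !block_mxEdr.
Qed.

(** Deflation followed by the induction hypothesis for the remaining block.
    The quantifiers matter: K is chosen before eta, so that the estimate stays
    valid when a finer estimate of the diagonal difference is obtained later.
    The diagonal is merely required to be eta-close, for which the Hoelder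
    bound on each new eigenvalue, with an exponent that degrades along the
    induction, is good enough. *)
Lemma schur_lipschitz_diag n (C M : R) : 0 <= C -> 0 <= M ->
  exists2 K : R, 0 <= K & forall eta : R, 0 < eta ->
  exists2 delta : R, 0 < delta & forall T0 B : 'M[R[i]]_n,
    upper_triangular T0 -> enorm T0 <= M -> corank1_bounded C T0 ->
    enorm (B - T0) <= delta ->
  exists U T : 'M[R[i]]_n, [/\ schur_decomposition B U T,
    \sum_i cabs (T i i - T0 i i) <= eta &
    enorm (U - 1%:M) <= K * (enorm (B - T0) + \sum_i cabs (T i i - T0 i i))].
Proof.
move=> C0 M0; elim: n => [|n [K' K'0 IHn]].
  exists 0 => // eta eta0; exists 1 => // T0 B _ _ _ _; exists 1%:M, B.
  rewrite !big_ord0 (flatmx0 (_ - _)) enorm0 mul0r; split => //; last exact: ltW.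
  split; first by apply/unitarymxP; rewrite [LHS]flatmx0 [RHS]flatmx0.
    by apply/is_trig_mxP => -[].
  by rewrite [LHS]flatmx0 [RHS]flatmx0.
rewrite -[n.+1]/(1 + n)%N.
have [K1 [rho1 [K10 rho10 deflate]]] := schur_deflation n C0 M0.
pose N : R := (1 + n)%:R ^+ 2.
have N0 : 0 <= N by rewrite exprn_ge0.
exists (N * K' * (K1 + 1) + K1).
  by rewrite addr_ge0 // !mulr_ge0 // addr_ge0.
move=> eta eta0.
have [|delta' delta'0 {}IHn] := IHn (eta / 2); first by rewrite divr_gt0.
pose M2 : R := (1 + n)%:R * M + M + 1.
have M21 : 1 <= M2 by rewrite lerDr addr_ge0 // mulr_ge0.
pose D : R := #|{perm 'I_(1 + n)}|%:R * M2 ^+ (1 + n).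
have D0 : 0 <= D by rewrite mulr_ge0 // exprn_ge0 // (le_trans ler01).
(* eta1 bounds the distance between the first eigenvalues: one half of eta is
   left to the other ones, rho1 lets the deflation apply, and the last term
   keeps the remaining block within the reach of the induction hypothesis *)
pose eta1 : R :=
  Num.min (eta / 2) (Num.min (rho1 / 2) (delta' / (2 * (K1 + 1)))).
have eta10 : 0 < eta1.
  by rewrite !lt_min !divr_gt0 // mulr_gt0 // ltr_wpDl.
have eta1_eta : eta1 <= eta / 2 by rewrite ge_min lexx.
have eta1_rho : eta1 <= rho1 / 2 by rewrite !ge_min lexx orbT.
have eta1_delta : eta1 * (2 * (K1 + 1)) <= delta'.
  by rewrite -ler_pdivlMr ?mulr_gt0 ?ltr_wpDl // !ge_min lexx !orbT.
pose delta : R := Num.min eta1 (Num.min 1 (eta1 ^+ (1 + n) / (D + 1))).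
have D1 : 0 < D + 1 by rewrite ltr_wpDl.
have delta0 : 0 < delta.
  rewrite lt_min eta10 /= lt_min ltr01 /= divr_gt0 //; exact: exprn_gt0.
have delta_eta1 : delta <= eta1 by rewrite ge_min lexx.
have delta_1 : delta <= 1 by rewrite ge_min [X in _ || X]ge_min lexx !orbT.
have delta_D : delta * (D + 1) <= eta1 ^+ (1 + n).
  by rewrite -ler_pdivlMr // ge_min [X in _ || X]ge_min lexx !orbT.
exists delta => // T B.
move=> /(@upper_triangularP n) [l0 [r0 [T0 [T0ut TE]]]] TM TC BT.
have l0M : cabs l0 <= M.
  apply: le_trans TM; rewrite TE enorm_block enorm_scalar1.
  by rewrite -!addrA lerDl !addr_ge0 ?enorm_ge0.
have [mu mu_near mu_eig] :
    exists2 mu, cabs (mu - l0) <= eta1 & \det (mu%:M - B) = 0.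
  apply: eigenvalue_near => //; first exact: ltW.
  have -> : \det (l0%:M - B) = \det (l0%:M - B) - \det (l0%:M - T).
    suff -> : \det (l0%:M - T) = 0 by rewrite subr0.
    rewrite TE (@scalar_mx_block _ 1 n) opp_block_mx add_block_mx.
    by rewrite subrr oppr0 addr0 det_ublock det0 mul0r.
  apply: le_trans (det_lipschitz M21 _ _) _.
  - apply: (le_trans (enormD _ _)); rewrite enorm_scalar enormN /M2 -addrA.
    apply: lerD; first by rewrite ler_wpM2l.
    have -> : B = T + (B - T) by rewrite addrC subrK.
    apply: (le_trans (enormD _ _)); apply: lerD => //.
    exact: le_trans BT delta_1.
  - apply: (le_trans (enormD _ _)); rewrite enorm_scalar enormN /M2 -addrA.
    apply: lerD; first by rewrite ler_wpM2l.
    by rewrite (le_trans TM) // lerDl.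
  rewrite -/D opprB addrC addrA subrK -enormBC; apply: le_trans delta_D.
  rewrite mulrC; apply: ler_pM => //; first exact: enorm_ge0.
  by rewrite lerDl.
pose d := enorm (B - T) + cabs (mu - l0).
have d0 : 0 <= d by rewrite addr_ge0 ?enorm_ge0 ?cabs_ge0.
have d_eta1 : d <= 2 * eta1 by rewrite /d; lra.
have [G GC GT] := TC (lshift n 0).
have TC' : corank1_bounded C T0.
  move=> i; have [H HC HT] := TC (rshift 1 i).
  exists (drsubmx (H : 'M[R[i]]_(1 + n))).
    apply: le_trans HC.
    rewrite -[in leRHS](submxK (H : 'M[R[i]]_(1 + n))) enorm_block.
    by rewrite addrA lerDr !addr_ge0 ?enorm_ge0.
  move: HT; rewrite TE block_mxEdr (@scalar_mx_block _ 1 n).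
  rewrite opp_block_mx add_block_mx.
  by rewrite !oppr0 !addr0; apply: left_quasi_inverse_drsubmx.
rewrite TE block_mxEul mxE eqxx mulr1n -TE in GT.
rewrite TE in GT TM BT d d0 d_eta1 *.
have [|W [r [B' [Wu WB W1 B'T]]]] := deflate G l0 r0 T0 B mu GT GC TM mu_eig.
  by rewrite -/d; lra.
rewrite -/d in W1 B'T.
have T0M : enorm T0 <= M.
  apply: le_trans TM; rewrite enorm_block addrA lerDr.
  by rewrite !addr_ge0 ?enorm_ge0.
have [|U' [T' [[U'u T'ut B'E] T'T U'1]]] := IHn T0 B' T0ut T0M TC'.
  apply: (le_trans B'T).
  have := ler_wpM2l K10 d_eta1; lra.
pose V : 'M[R[i]]_(1 + n) := block_mx 1%:M 0 0 U'.
have Vadj : V^t* = block_mx 1%:M 0 0 (U'^t*).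
  by rewrite tr_block_mx map_block_mx !trmx0 !map_mx0 trmx1 map_mx1.
have Vu : V \is unitarymx.
  apply/unitarymxP; rewrite Vadj mulmx_block.
  by rewrite !(mulmx0, mul0mx, addr0, add0r) mulmx1
    (unitarymxP U'u) -scalar_mx_block.
pose S : 'M[R[i]]_(1 + n) := block_mx mu%:M (r *m U') 0 T'.
exists (W *m V), S; rewrite sum_diag_block; split.
- split; first exact: mul_unitarymx.
    by rewrite upper_triangular_block.
  have VSV : V *m S *m V^t* = W^t* *m B *m W.
    rewrite WB Vadj !mulmx_block.
    rewrite !(mulmx0, mul0mx, addr0, add0r, mulmx1, mul1mx).
    by rewrite -mulmxA (unitarymxP U'u) mulmx1 -B'E.
  rewrite trmx_mul map_mxM !mulmxA.
  rewrite -[W *m V *m S]mulmxA -[W *m (V *m S) *m _]mulmxA.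
  rewrite VSV !mulmxA (unitarymxP Wu) mul1mx -mulmxA.
  by rewrite (unitarymxP Wu) mulmx1.
- lra.
have -> : W *m V - 1%:M = W *m (V - 1%:M) + (W - 1%:M).
  by rewrite mulmxBr mulmx1 addrA subrK.
apply: (le_trans (enormD _ _)).
have -> : enorm (B - block_mx l0%:M r0 0 T0)
    + (cabs (mu - l0) + \sum_i cabs (T' i i - T0 i i))
  = d + \sum_i cabs (T' i i - T0 i i) by rewrite addrA.
set s := \sum_i _ in U'1 *.
have s0 : 0 <= s by apply: sumr_ge0 => i _; apply: cabs_ge0.
rewrite [leRHS]mulrDl; apply: lerD; last first.
  by apply: (le_trans W1); rewrite ler_wpM2l // lerDl.
have V1 : enorm (V - 1%:M) = enorm (U' - 1%:M).
  rewrite /V scalar_mx_block opp_block_mx add_block_mx !subrr enorm_block.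
  by rewrite !enorm0 !add0r.
apply: (le_trans (enormM _ _)).
rewrite V1 -[N * K' * _ * _]mulrA -[N * K' * _]mulrA.
apply: ler_pM; rewrite ?enorm_ge0 //; first exact: (enorm_unitary Wu).
apply: (le_trans U'1); apply: ler_wpM2l => //.
have : 0 <= K1 * s by rewrite mulr_ge0.
lra.
Qed.

End SchurPerturbation.

(** * Comparison with the operator norm *)

Section OperatorNorm.
Context {R : realType}.

Lemma cabs_le_eucl_norm n (x : 'cV[R[i]]_n) k : cabs (x k 0) <= eucl_norm x.
Proof.
rewrite -[cabs _]ger0_norm ?cabs_ge0 // -sqrtr_sqr; apply: ler_wsqrtr.
by rewrite (bigD1 k) //= lerDl sumr_ge0 // => i _; apply: sqr_ge0.
Qed.

Lemma eucl_norm_le_enorm n (x : 'cV[R[i]]_n) : eucl_norm x <= enorm x.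
Proof.
rewrite -[leRHS]ger0_norm ?enorm_ge0 // -sqrtr_sqr; apply: ler_wsqrtr.
rewrite expr2 {1}/enorm mulr_suml; apply: ler_sum => i _.
rewrite big_ord1 expr2.
by rewrite ler_wpM2l ?cabs_ge0 ?cabs_le_enorm.
Qed.

Lemma eucl_norm_mulmx_le n (A : 'M[R[i]]_n) (x : 'cV[R[i]]_n) :
  eucl_norm x <= 1 -> eucl_norm (A *m x) <= n%:R * enorm A.
Proof.
move=> x1; apply: (le_trans (eucl_norm_le_enorm _)).
apply: (le_trans (enormM _ _)); rewrite mulrC ler_wpM2r ?enorm_ge0 //.
rewrite -[n in n%:R]card_ord -sum1_card natr_sum; apply: ler_sum => i _.
by rewrite big_ord1 (le_trans (cabs_le_eucl_norm _ _)).
Qed.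

Lemma eucl_norm_le_op_norm n (A : 'M[R[i]]_n) (x : 'cV[R[i]]_n) :
  eucl_norm x <= 1 -> eucl_norm (A *m x) <= op_norm A.
Proof.
move=> x1; apply: ub_le_sup; last by exists x.
by exists (n%:R * enorm A) => _ [z z1 <-]; apply: eucl_norm_mulmx_le.
Qed.

Lemma op_norm_le_enorm n (A : 'M[R[i]]_n) : op_norm A <= n%:R * enorm A.
Proof.
apply: ge_sup => [|_ [x x1 <-]]; last exact: eucl_norm_mulmx_le.
exists (eucl_norm (A *m 0)); exists 0 => //=.
by apply: (le_trans (eucl_norm_le_enorm _)); rewrite enorm0.
Qed.

Lemma enorm_le_op_norm n (A : 'M[R[i]]_n) : enorm A <= n%:R ^+ 2 * op_norm A.
Proof.
have Aij i j : cabs (A i j) <= op_norm A.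
  have -> : A i j = (A *m (delta_mx j 0 : 'cV[R[i]]_n)) i 0.
    by rewrite -colE mxE.
  apply: (le_trans (cabs_le_eucl_norm _ _)).
  apply: eucl_norm_le_op_norm; apply: (le_trans (eucl_norm_le_enorm _)).
  rewrite /enorm (bigD1 j) //= big_ord1 mxE !eqxx cabs1 big1 ?addr0 // => k kj.
  by rewrite big_ord1 mxE (negPf kj) cabs0.
apply: (@le_trans _ _ (\sum_(i < n) \sum_(j < n) op_norm A)).
  by apply: ler_sum => i _; apply: ler_sum => j _.
by rewrite !sumr_const !card_ord -mulrnA expr2 -natrM mulr_natl.
Qed.

Lemma op_norm_ge0 n (A : 'M[R[i]]_n) : 0 <= op_norm A.
Proof.
apply: (@le_trans _ _ (eucl_norm (A *m 0))); first exact: sqrtr_ge0.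
apply: eucl_norm_le_op_norm.
by apply: (le_trans (eucl_norm_le_enorm _)); rewrite enorm0.
Qed.

End OperatorNorm.

(** * Uniform constants over the spectrum and the exponent 1/n *)

Section Spectrum.
Context {R : realType}.

Lemma seq_uniform_bound (I : eqType) (s : seq I) (P : I -> R -> Prop) :
  (forall i c c', P i c -> c <= c' -> P i c') ->
  (forall i, exists c, P i c) ->
  exists2 c, 0 <= c & forall i, i \in s -> P i c.
Proof.
move=> Pmono exP; elim: s => [|i s [c c0 Pc]]; first by exists 0.
have [c' Pc'] := exP i; exists (Num.max c c'); first by rewrite le_max c0.
move=> j; rewrite inE => /orP [/eqP ->|js].
  by apply: Pmono Pc' _; rewrite le_max lexx orbT.
by apply: Pmono (Pc j js) _; rewrite le_max lexx.
Qed.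

Lemma separation (s : seq R[i]) :
  exists2 eta : R, 0 < eta &
    forall x y, x \in s -> y \in s -> x != y -> 2 * eta <= cabs (x - y).
Proof.
have [||c c0 sep] := @seq_uniform_bound (R[i] * R[i])%type
    [seq (x, y) | x <- s, y <- s]
    (fun p c => p.1 != p.2 -> (cabs (p.1 - p.2))^-1 <= c).
- by move=> p c c' pc cc' /pc /le_trans; apply.
- by move=> p; exists (cabs (p.1 - p.2))^-1.
exists (2 * (c + 1))^-1; first by rewrite invr_gt0 mulr_gt0 // ltr_wpDl.
move=> x y xs ys xy.
have xy0 : 0 < cabs (x - y).
  by rewrite lt_neqAle eq_sym cabs_eq0 subr_eq0 xy cabs_ge0.
rewrite invfM mulrA divff // mul1r -[leRHS]invrK.
rewrite lef_pV2 ?posrE ?invr_gt0 ?ltr_wpDl //.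
have := sep (x, y) _ xy => /= le_c; rewrite (@le_trans _ _ c) ?lerDl // le_c //.
by apply/allpairsP; exists (x, y).
Qed.

Lemma enorm_unitary_conj n (U X : 'M[R[i]]_n) : U \is unitarymx ->
  enorm (U^t* *m X *m U) <= n%:R ^+ 4 * enorm X.
Proof.
move=> Uu.
have -> : n%:R ^+ 4 * enorm X = n%:R ^+ 2 * enorm X * n%:R ^+ 2 by ring.
apply: (le_trans (enormM _ _)).
apply: ler_pM; rewrite ?enorm_ge0 ?enorm_unitary //.
apply: (le_trans (enormM _ _)); rewrite enorm_adj.
by apply: ler_wpM2r; rewrite ?enorm_ge0 ?enorm_unitary.
Qed.

Lemma schur_decompositionE n (A U T : 'M[R[i]]_n) :
  schur_decomposition A U T -> T = U^t* *m A *m U.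
Proof.
move=> [Uu _ ->]; rewrite !mulmxA unitarymx_mulVmx // mul1mx.
by rewrite -mulmxA unitarymx_mulVmx // mulmx1.
Qed.

Lemma det_upper_triangular_sub n (T : 'M[R[i]]_n) a : upper_triangular T ->
  \det (a%:M - T) = \prod_i (a - T i i).
Proof.
move=> /is_trig_mxP Tut; rewrite -det_tr det_trig.
  by apply: eq_bigr => i _; rewrite !mxE eqxx mulr1n.
apply/is_trig_mxP => i j ij; have := Tut i j ij; rewrite !mxE => ->.
by rewrite -(inj_eq val_inj) /= gtn_eqF // subr0.
Qed.

Lemma schur_diag_eigenvalue n (A U T : 'M[R[i]]_n) i :
  schur_decomposition A U T -> \det ((T i i)%:M - A) = 0.
Proof.
move=> AUT; have [Uu Tut AE] := AUT.
have -> : (T i i)%:M - A = U *m ((T i i)%:M - T) *m U^t*.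
  by rewrite mulmxBr mulmxBl -AE scalar_mxC -mulmxA (unitarymxP Uu) mulmx1.
rewrite !det_mulmx det_upper_triangular_sub // (bigD1 i) //= subrr.
by rewrite mul0r mulr0 mul0r.
Qed.

Lemma spectrum n (A : 'M[R[i]]_n) :
  exists s : seq R[i], forall a, (a \in s) = (\det (a%:M - A) == 0).
Proof.
have [s] := closed_field_poly_normal (char_poly A).
rewrite (monicP (char_poly_monic A)) scale1r => sE; exists s => a.
by rewrite -horner_char_poly sE -root_prod_XsubC.
Qed.

(** There are finitely many eigenvalues, hence one bound for their
    quasi-inverses; conjugation by U carries each of them from A to T at the
    cost of a factor that depends on n only. *)
Lemma nonderogatory_corank1_bounded n (A : 'M[R[i]]_n) : nonderogatory A ->
  exists2 C : R, 0 <= C & forall U T, schur_decomposition A U T ->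
    corank1_bounded C T.
Proof.
move=> ndA; have [s sE] := spectrum A.
have [||c c0 cP] := @seq_uniform_bound _ s
    (fun a c => exists2 G, enorm G <= c & left_quasi_inverse G (A - a%:M)).
- by move=> a c c' [G Gc GA] cc'; exists G => //; apply: le_trans cc'.
- move=> a; have [G GA] := left_quasi_inverse_exists (nonderogatory_rank a ndA).
  by exists (enorm G), G.
exists (n%:R ^+ 4 * c); first by rewrite mulr_ge0 // exprn_ge0.
move=> U T AUT i; have [Uu _ _] := AUT.
have [|G Gc GA] := cP (T i i); first by rewrite sE (schur_diag_eigenvalue _ AUT).
exists (U^t* *m G *m U).
  apply: (le_trans (enorm_unitary_conj _ Uu)).
  by rewrite ler_wpM2l // exprn_ge0.
have -> : T - (T i i)%:M = U^t* *m (A - (T i i)%:M) *m U.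
  rewrite mulmxBr mulmxBl -(schur_decompositionE AUT) mul_mx_scalar -scalemxAl.
  by rewrite unitarymx_mulVmx // scalemx1.
exact: left_quasi_inverse_conj (unitarymxP Uu) GA.
Qed.

(** If eta is at most half the gap between distinct eigenvalues, T0 i i is the
    one nearest to T i i.  Each factor of det (T i i - T0) is then at least
    |T i i - T0 i i|, while det (T i i - B) vanishes. *)
Lemma schur_diag_holder n (M eta : R) (B T0 U T : 'M[R[i]]_n) :
  1 <= M -> enorm T0 <= M -> enorm B <= M ->
  upper_triangular T0 -> schur_decomposition B U T ->
  (forall i j, T0 i i != T0 j j -> 2 * eta <= cabs (T0 i i - T0 j j)) ->
  (forall i, cabs (T i i - T0 i i) <= eta) -> forall i,
  cabs (T i i - T0 i i) ^+ n <=
    #|{perm 'I_n}|%:R * (n%:R * (M + eta) + M) ^+ n * enorm (B - T0).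
Proof.
move=> M1 T0M BM T0ut BUT sep near i; pose mu := T i i.
have eta0 : 0 <= eta := le_trans (cabs_ge0 _) (near i).
apply: (@le_trans _ _ (cabs (\det (mu%:M - T0) - \det (mu%:M - B)))).
  rewrite (schur_diag_eigenvalue i BUT) subr0.
  rewrite det_upper_triangular_sub // cabs_prod.
  have -> : cabs (T i i - T0 i i) ^+ n = \prod_(j < n) cabs (T i i - T0 i i).
    by rewrite prodr_const card_ord.
  apply: ler_prod => j _.
  rewrite cabs_ge0 /=; have [->//|ij] := eqVneq (T0 i i) (T0 j j).
  have := sep i j ij; have := near i.
  have := cabsD (T0 i i - mu) (mu - T0 j j).
  rewrite addrA subrK (cabsBC (T0 i i) mu) /mu.
  lra.
have mu_le : cabs mu <= M + eta.
  rewrite -(subrK (T0 i i) mu) addrC; apply: (le_trans (cabsD _ _)).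
  apply: lerD; last exact: near.
  exact: le_trans (cabs_le_enorm _ _ _) T0M.
have bound (X : 'M[R[i]]_n) :
    enorm X <= M -> enorm (mu%:M - X) <= n%:R * (M + eta) + M.
  move=> XM; apply: (le_trans (enormD _ _)); rewrite enorm_scalar enormN.
  by apply: lerD => //; rewrite ler_wpM2l.
apply: le_trans (det_lipschitz _ (bound _ T0M) (bound _ BM)) _.
  by apply: (le_trans M1); rewrite lerDr mulr_ge0 // addr_ge0 // (le_trans ler01).
suff -> : mu%:M - T0 - (mu%:M - B) = B - T0 by [].
by rewrite opprB addrC addrA subrK.
Qed.

Lemma le_powR_invn n (x z : R) : (0 < n)%N -> 0 <= x -> x ^+ n <= z ->
  x <= z `^ (n%:R^-1).
Proof.
move=> n0 x0 xz; have n1 : n%:R != 0 :> R by rewrite pnatr_eq0 -lt0n.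
have xn0 : 0 <= x ^+ n by rewrite exprn_ge0.
have {1}-> : x = (x ^+ n) `^ (n%:R^-1).
  by rewrite -powR_mulrn // -powRrM mulfV // powRr1.
by apply: ge0_ler_powR; rewrite ?invr_ge0 ?nnegrE // (le_trans xn0).
Qed.

End Spectrum.

(** * The perturbation theorem *)

Theorem theorem1p2 (R : realType) (n : nat) (hn : (0 < n)%N)
    (A0 : 'M[R[i]]_n) (hA0 : nonderogatory A0) :
  exists K eps : R, [/\ 0 < K, 0 < eps &
    forall U0 T0 : 'M[R[i]]_n, schur_decomposition A0 U0 T0 ->
    forall A : 'M[R[i]]_n, op_norm (A - A0) < eps ->
    exists U T : 'M[R[i]]_n, schur_decomposition A U T /\
      op_norm (U - U0) + op_norm (T - T0)
        <= K * op_norm (A - A0) `^ (n%:R^-1)].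
Proof.
have [C C0 corank1] := nonderogatory_corank1_bounded hA0.
have [s sE] := spectrum A0.
have [eta eta0 sep] := separation s.
pose M : R := n%:R ^+ 4 * enorm A0.
have M0 : 0 <= M by rewrite mulr_ge0 ?enorm_ge0 // exprn_ge0.
have [K0 K00 /(_ eta eta0) [delta delta0 schur_near]] :=
  schur_lipschitz_diag n C0 M0.
(* n ^ 4 for the conjugation by U0, n ^ 2 to pass to the operator norm *)
pose c1 : R := n%:R ^+ 4 * n%:R ^+ 2.
have n1 : 1 <= n%:R :> R by rewrite ler1n.
have c10 : 0 < c1 by rewrite mulr_gt0 // exprn_gt0 // ltr0n.
pose M3 := M + c1 + 1.
pose D : R := #|{perm 'I_n}|%:R * (n%:R * (M3 + eta) + M3) ^+ n.
have M31 : 1 <= M3 by rewrite lerDr addr_ge0 // ltW.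
have M30 : 0 <= M3 := le_trans ler01 M31.
have D0 : 0 <= D.
  by rewrite mulr_ge0 // exprn_ge0 // addr_ge0 // mulr_ge0 // addr_ge0 // ltW.
pose E : R := (D * c1) `^ n%:R^-1.
pose c2 := c1 + n%:R * E.
pose c3 := K0 * c2.
have c30 : 0 <= c3 by rewrite mulr_ge0 // addr_ge0 ?mulr_ge0 ?powR_ge0 // ltW.
pose K := n%:R * (n%:R ^+ 2 * c3 + ((n%:R ^+ 2 + 1) * c3 * M3 + c1)).
have K_ge0 : 0 <= K.
  rewrite mulr_ge0 // addr_ge0 //; first by rewrite mulr_ge0 // exprn_ge0.
  by rewrite addr_ge0 ?(ltW c10) // mulr_ge0 // mulr_ge0 // addr_ge0 // exprn_ge0.
exists (K + 1), (Num.min 1 (delta / c1)); split.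
- by rewrite ltr_wpDl.
- by rewrite lt_min ltr01 divr_gt0.
move=> U0 T0 AUT0 A; rewrite lt_min => /andP [].
set t := op_norm (A - A0) => t1; rewrite ltr_pdivlMr // mulrC => t_delta.
have t0 : 0 <= t by apply: op_norm_ge0.
set q := t `^ n%:R^-1.
have q0 : 0 <= q by apply: powR_ge0.
have tq : t <= q.
  apply: le_powR_invn => //; rewrite -[leRHS]expr1.
  by apply: ler_wiXn2l => //; exact: ltW.
have [U0u T0ut A0E] := AUT0.
have T0E := schur_decompositionE AUT0.
have T0M : enorm T0 <= M by rewrite T0E; apply: enorm_unitary_conj.
pose B := U0^t* *m A *m U0.
have BT : enorm (B - T0) <= c1 * t.
  have -> : B - T0 = U0^t* *m (A - A0) *m U0 by rewrite T0E mulmxBr mulmxBl.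
  apply: (le_trans (enorm_unitary_conj _ U0u)); rewrite -[leRHS]mulrA.
  by rewrite ler_wpM2l ?exprn_ge0 // enorm_le_op_norm.
have [|V [T [BVT T_eta V1]]] := schur_near T0 B T0ut T0M (corank1 _ _ AUT0).
  by apply: (le_trans BT); apply: ltW.
have [Vu Tut BE] := BVT.
have BM : enorm B <= M3.
  have -> : B = T0 + (B - T0) by rewrite addrC subrK.
  apply: (le_trans (enormD _ _)); rewrite /M3 -addrA; apply: lerD => //.
  apply: (le_trans BT); apply: (@le_trans _ _ c1); last by rewrite lerDl.
  by rewrite ler_piMr // ltW.
have Ti_eta i : cabs (T i i - T0 i i) <= eta.
  apply: le_trans T_eta; rewrite (bigD1 i) //= lerDl.
  by apply: sumr_ge0 => j _; apply: cabs_ge0.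
(* The crude bound eta is replaced by the exponent 1/n. *)
have Ti i : cabs (T i i - T0 i i) <= E * q.
  rewrite /E /q -powRM ?(mulr_ge0 D0 (ltW c10)) //.
  apply: le_powR_invn => //; first exact: cabs_ge0.
  have T0M3 : enorm T0 <= M3.
    by apply: (le_trans T0M); rewrite /M3 -addrA lerDl addr_ge0 // ltW.
  apply: (le_trans (schur_diag_holder M31 T0M3 BM T0ut BVT _ Ti_eta i)).
    by move=> j k; apply: sep; rewrite sE (schur_diag_eigenvalue _ AUT0).
  by rewrite -/D -[leRHS]mulrA ler_wpM2l.
have sum_q : enorm (B - T0) + \sum_i cabs (T i i - T0 i i) <= c2 * q.
  rewrite /c2 mulrDl; apply: lerD.
    by apply: (le_trans BT); rewrite ler_wpM2l // ltW.
  apply: (@le_trans _ _ (\sum_(i < n) E * q)); first by apply: ler_sum.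
  by rewrite sumr_const card_ord -mulrA mulr_natl.
have Vq : enorm (V - 1%:M) <= c3 * q.
  by apply: (le_trans V1); rewrite /c3 -mulrA ler_wpM2l.
exists (U0 *m V), T; split.
  split=> //; first exact: mul_unitarymx.
  rewrite trmx_mul map_mxM !mulmxA.
  rewrite -[U0 *m V *m T]mulmxA -[U0 *m (V *m T) *m _]mulmxA.
  rewrite -BE /B !mulmxA (unitarymxP U0u) mul1mx -mulmxA.
  by rewrite (unitarymxP U0u) mulmx1.
apply: (@le_trans _ _ (K * q)); last by rewrite ler_wpM2r // lerDl.
rewrite /K -mulrA.
apply: (@le_trans _ _ (n%:R * (enorm (U0 *m V - U0) + enorm (T - T0)))).
  by rewrite mulrDr; apply: lerD; apply: op_norm_le_enorm.
rewrite ler_wpM2l // mulrDl; apply: lerD.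
  have -> : U0 *m V - U0 = U0 *m (V - 1%:M) by rewrite mulmxBr mulmx1.
  apply: (le_trans (enormM _ _)); rewrite -mulrA.
  by apply: ler_pM; rewrite ?enorm_ge0 ?enorm_unitary.
have -> : T - T0 = (T - B) + (B - T0) by rewrite addrA subrK.
apply: (le_trans (enormD _ _)); rewrite mulrDl; apply: lerD; last first.
  by apply: (le_trans BT); rewrite ler_wpM2l // ltW.
rewrite (schur_decompositionE BVT); apply: (le_trans (unitary_conj_near _ Vu)).
rewrite -[leRHS]mulrA [M3 * q]mulrC mulrA -[_ * c3 * q]mulrA.
apply: ler_pM; rewrite ?mulr_ge0 ?enorm_ge0 ?addr_ge0 ?exprn_ge0 //.
by rewrite ler_wpM2l // addr_ge0 // exprn_ge0.
Qed.
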